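(* Let $\epsilon,\delta>0$ be real numbers, let $n$ be a positive integer, and let $\mathcal{A}\subset\{0,1\}^n$. Then for at least a $1-\epsilon$ proportion of the elements $x\in\{0,1\}^n$ (i.e. for at least $(1-\epsilon)2^n$ of them) the following holds: there exists $P\in[0,1]^n$ such that $$\|P\|_2^2\le \frac{\log(2/\epsilon)}{2\delta\epsilon}\qquad\text{and}\qquad \mathbb{P}(x+Y_P\in\mathcal{A})\ge \mu(\mathcal{A})-\delta .$$
   Context: $\mu(\mathcal{A})=|\mathcal{A}|/2^n$ for $\mathcal{A}\subset\{0,1\}^n$. For $P=(P_1,\dots,P_n)\in[0,1]^n$, $Y_P$ denotes the random vector in $\{0,1\}^n$ whose coordinates are independent Bernoulli random variables with $\mathbb{P}((Y_P)_i=1)=P_i$. Addition in $\{0,1\}^n$ is coordinatewise modulo 2 (i.e. in $\mathbb{F}_2^n$). $\|P\|_2^2=\sum_i P_i^2$, and $\log$ is the natural logarithm. *)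

(* Defs.v *)
From HB Require Import structures.
From mathcomp Require Import all_boot all_order all_algebra.
From mathcomp Require Import boolp reals exp bernoulli_distribution.

Set Implicit Arguments.
Unset Strict Implicit.
Unset Printing Implicit Defensive.

Import Order.TTheory GRing.Theory Num.Theory.
Local Open Scope ring_scope.

(* {0,1}^n. The library makes bool the field with two elements, with exclusive
   or as addition, so the pointwise sum of finite functions is the sum in
   F_2^n (lemma cube_addE below). *)
Notation cube n := {ffun 'I_n -> bool}.

Definition mu (R : realType) (n : nat) (A : {set cube n}) : R :=
  #|A|%:R / 2 ^+ n.

(* The law of Y_P: its mass function is the product of the Bernoulli ones.
   Lemma prob_bernoulli_vec_cylinder shows that under this law the coordinates
   are mutually independent and the i-th one is Bernoulli of parameter P i. *)
Definition bernoulli_vec_pmf (R : realType) (n : nat) (P : 'I_n -> R)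
    (y : cube n) : R :=
  \prod_(i < n) bernoulli_pmf (P i) (y i).

Definition prob_bernoulli_vec (R : realType) (n : nat) (P : 'I_n -> R)
    (E : {set cube n}) : R :=
  \sum_(y in E) bernoulli_vec_pmf P y.

Lemma cube_addE (n : nat) (x y : cube n) (i : 'I_n) :
  (x + y) i = x i (+) y i.
Proof. by rewrite ffunE. Qed.

Lemma bernoulli_vec_pmf_ge0 (R : realType) (n : nat) (P : 'I_n -> R)
    (y : cube n) :
  (forall i, 0 <= P i <= 1) -> 0 <= bernoulli_vec_pmf P y.
Proof. by move=> P01; apply: prodr_ge0 => i _; exact: bernoulli_pmf_ge0. Qed.

Lemma prob_bernoulli_vec_cylinder (R : realType) (n : nat) (P : 'I_n -> R)
    (J : {set 'I_n}) (b : cube n) :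
  prob_bernoulli_vec P [set y : cube n | [forall i in J, y i == b i]]
  = \prod_(i in J) bernoulli_pmf (P i) (b i).
Proof.
rewrite /prob_bernoulli_vec /bernoulli_vec_pmf.
pose Q i : pred bool := [pred c | (i \in J) ==> (c == b i)].
rewrite (eq_bigl (fun y : cube n => y \in family Q)); last first.
  move=> y; rewrite inE; apply/forallP/familyP => H i; first exact: H.
  exact: (H i).
rewrite -(bigA_distr_big_dep _ (fun i c => bernoulli_pmf (P i) c)) /=.
rewrite [RHS]big_mkcond /=; apply: eq_bigr => i _.
rewrite big_mkcond big_bool /Q /=.
case: (i \in J) => /=; last by rewrite /bernoulli_pmf addrC subrK.
by case: (b i); rewrite /= ?addr0 ?add0r.
Qed.

Lemma prob_bernoulli_vecT (R : realType) (n : nat) (P : 'I_n -> R) :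
  prob_bernoulli_vec P [set: cube n] = 1.
Proof.
have := prob_bernoulli_vec_cylinder P set0 [ffun=> false].
rewrite big_set0 => <-; congr prob_bernoulli_vec.
by apply/setP => y; rewrite !inE; apply/esym/forallP => i; rewrite inE.
Qed.

(* Main.v *)
(* Let B be the set of bad x, suppose |B| > epsilon 2^n, and let X be uniform on
   B. Reveal the coordinates of X one at a time; given the past, the next one
   takes its two values with masses a >= b, and flipping it with probability
   (a - b) / (2 a) when it took the more likely value makes it uniform. The
   flip probabilities P(X) depend on X only, so given X the noise Y_P(X) has
   independent coordinates, while X + Y_P(X) is uniform on the cube. The chain
   rule for relative entropy bounds E|P(X)|^2 by ln (2^n / |B|) < ln (1 / epsilon),
   so by Markov |P(X)|^2 exceeds the allowed bound with probability < delta;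
   otherwise P(X + Y_P(X) in A | X) < mu A - delta as X is bad. Averaging over X
   contradicts P(X + Y_P(X) in A) = mu A. *)
Require Import Defs.
From mathcomp Require Import all_boot all_order all_algebra.
From mathcomp Require Import boolp reals exp.
From mathcomp Require Import ring lra.
From mathcomp Require Import functions topology normedtype derive realfun.
From mathcomp Require Import bernoulli_distribution.
Import Order.TTheory GRing.Theory Num.Theory.
Import numFieldNormedType.Exports.
Local Open Scope ring_scope.

(** * Logarithmic estimates for a biased bit *)

Lemma ge_ln_1BV (R : realType) (y : R) : 0 < y -> 1 - y^-1 <= ln y.
Proof.
move=> y0; have yV0 : 0 < y^-1 by rewrite invr_gt0.
have := @le_ln1Dx R (y^-1 - 1); rewrite addrCA subrr addr0 lnV ?posrE//.
by move=> /(_ ltac:(lra)); lra.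
Qed.

Lemma is_derive_mul_ln (R : realType) (h : R -> R) (x dh : R) :
  is_derive x 1 h dh -> 0 < h x ->
  is_derive x 1 (fun y => h y * ln (h y)) (dh * (ln (h x) + 1)).
Proof.
move=> hD hx0.
have lnD := is_derive1_ln hx0.
have cD : is_derive x 1 (@ln R \o h) ((h x)^-1 * dh) by exact: is_derive1_comp.
have := is_deriveM hD cD.
rewrite (_ : dh * _ = h x *: ((h x)^-1 * dh) + ln (h x) *: dh) //.
rewrite /GRing.scale /= mulrA divff ?gt_eqF//; ring.
Qed.

(* The cubic is chosen to lie above the normalized cost [t ^+ 2 / (1 + t)] of a
   flip, where [t = (a - b) / (a + b)], while having a polynomial derivative. *)
Lemma entropy_deficit_ge (R : realType) (t : R) : 0 <= t <= 1 ->
  t ^+ 2 - t ^+ 3 / 3 <= (1 + t) * ln (1 + t) + (1 - t) * ln (1 - t).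
Proof.
(* The endpoint [t = 1], where [ln (1 - t)] is not differentiable, is done by hand: [ln 2 >= 1 / 2]
   suffices. *)
move=> /andP[t0]; rewrite le_eqVlt => /orP[/eqP ->|t1].
  rewrite subrr mul0r addr0 !expr1n (_ : 1 + 1 = 2 :> R) //.
  have := @ge_ln_1BV R 2 ltac:(lra); lra.
pose f (x : R) :=
  (1 + x) * ln (1 + x) + (1 - x) * ln (1 - x) - (x ^+ 2 - x ^+ 3 / 3).
have fD (x : R) : -1 < x -> x < 1 ->
    is_derive x 1 f (ln (1 + x) - ln (1 - x) - (2 * x - x ^+ 2)).
  move=> x0 x1.
  have D1 : is_derive x 1 (fun y : R => 1 + y) 1.
    rewrite -[X in is_derive _ _ _ X]add0r.
    exact: (is_deriveD (is_derive_cst _ _ _) (is_derive_id _ _)).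
  have D2 : is_derive x 1 (fun y : R => 1 - y) (-1).
    rewrite -[- 1]add0r.
    exact: (is_deriveB (is_derive_cst _ _ _) (is_derive_id _ _)).
  have L1 := is_derive_mul_ln R _ x _ D1 ltac:(cbv beta; lra).
  have L2 := is_derive_mul_ln R _ x _ D2 ltac:(cbv beta; lra).
  have D3 : is_derive x 1 (fun y : R => y ^+ 2 - y ^+ 3 / 3) (2 * x - x ^+ 2).
    rewrite (_ : (fun y => _) = id ^+ 2 - 3^-1 \*: (id ^+ 3)); last first.
      by apply/funext => y; rewrite /= !fctE /GRing.scale/= mulrC.
    apply: is_derive_eq.
    by rewrite /GRing.scale /=; field.
  apply: (is_derive_eq (is_deriveB (is_deriveD L1 L2) D3)).
  ring.
suff : f 0 <= f t.
  by rewrite /f addr0 subr0 ln1 !expr0n /=; lra.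
have xI (x : R) : x \in `]0, t[ -> 0 < x /\ x < t.
  by rewrite in_itv /= => /andP[].
apply: (@ger0_derive1_ndecr R f 0 t) => //.
- by move=> x /xI[x0 xt]; apply: ex_derive; apply: fD; lra.
- move=> x /xI[x0 xt].
  have fx := fD x ltac:(lra) ltac:(lra).
  rewrite derive1E derive_val.
  (* Bounding the two logarithms separately leaves [x ^+ 3 / (1 + x)] as a lower bound for the
     derivative. *)
  have lnP := @ge_ln_1BV R (1 + x) ltac:(lra).
  have lnN := @le_ln1Dx R (- x) ltac:(lra).
  suff : 1 - (1 + x)^-1 >= x - x ^+ 2 by lra.
  have x10 : 0 < 1 + x by lra.
  rewrite -subr_ge0 (_ : _ - _ = x ^+ 3 / (1 + x)); last by field; lra.
  by rewrite divr_ge0 ?exprn_ge0 ?ltW.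
- apply: derivable_within_continuous => x; rewrite in_itv /= => /andP[x0 xt].
  by apply: ex_derive; apply: fD; lra.
Qed.

(** * Balancing one bit by random flips *)

(* [a] is the mass of the value taken by the coordinate and [b] that of the other
   value; for [a = 0] the division by zero gives [0]. *)
Definition flip_prob (R : realType) (a b : R) : R := Num.max 0 ((a - b) / (2 * a)).

Lemma flip_prob_itv (R : realType) (a b : R) : 0 <= a -> 0 <= b ->
  0 <= flip_prob R a b <= 1.
Proof.
move=> a0 b0; rewrite /flip_prob le_max lexx ge_max ler01 /=.
move: a0; rewrite le_eqVlt => /orP[/eqP <-|a0].
  by rewrite mulr0 invr0 mulr0 ler01.
by rewrite ler_pdivrMr; lra.
Qed.

Lemma flip_prob_small (R : realType) (a b : R) : 0 <= a -> a <= b ->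
  flip_prob R a b = 0.
Proof.
move=> a0 ab; apply/max_idPl.
by rewrite mulr_le0_ge0 ?invr_ge0; lra.
Qed.

(** The product form also covers [a = b = 0]. *)
Lemma mul_flip_prob_large (R : realType) (a b : R) : 0 <= b -> b <= a ->
  a * flip_prob R a b = (a - b) / 2.
Proof.
move=> b0 ba; rewrite /flip_prob (max_idPr _) ?divr_ge0; try lra.
have [a0|a0] := eqVneq a 0; first by rewrite {1}a0 mul0r; lra.
by field.
Qed.

(** The left side is the mass of the first value after the flips: what stays plus what arrives. Only
    the heavier value moves, giving away half of its excess. *)
Lemma flip_prob_balances (R : realType) (a b : R) : 0 <= a -> 0 <= b ->
  a * (1 - flip_prob R a b) + b * flip_prob R b a = (a + b) / 2.
Proof.
move=> a0 b0; case: (lerP b a) => [ba|/ltW ab].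
  by rewrite (flip_prob_small _ b a)// mulrBr mul_flip_prob_large//; lra.
by rewrite (flip_prob_small _ a b)// mul_flip_prob_large//; lra.
Qed.

(** The right side is [a + b] times the entropy of the normalized bit relative to the fair bit. By
    symmetry let [b <= a]; scaling by [(a + b) / 2] leaves an inequality in the bias [t] alone. *)
Lemma flip_prob_cost (R : realType) (a b : R) : 0 <= a -> 0 <= b ->
  a * flip_prob R a b ^+ 2 + b * flip_prob R b a ^+ 2 <=
  a * ln (2 * a / (a + b)) + b * ln (2 * b / (a + b)).
Proof.
wlog ba : a b / b <= a.
  move=> H a0 b0; case: (lerP b a) => [|/ltW] ?; first exact: H.
  by rewrite addrC [leRHS]addrC [a + b]addrC; apply: H.
move=> a0 b0; rewrite (flip_prob_small _ b a)// expr0n mulr0 addr0.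
move: a0; rewrite le_eqVlt => /orP[/eqP a0|a0].
  by have -> : b = 0; [lra|rewrite -a0 !mul0r addr0].
have s0 : 0 < a + b by lra.
pose t := (a - b) / (a + b).
have tE : t * (a + b) = a - b by rewrite /t divfK//; lra.
have t0 : 0 <= t by rewrite /t divr_ge0; lra.
have t1 : t <= 1 by rewrite /t ler_pdivrMr; lra.
have -> : 2 * a / (a + b) = 1 + t by rewrite /t; field; lra.
have -> : 2 * b / (a + b) = 1 - t by rewrite /t; field; lra.
have aE : a = (a + b) / 2 * (1 + t) by lra.
have bE : b = (a + b) / 2 * (1 - t) by lra.
rewrite expr2 mulrA mul_flip_prob_large//.
have -> : (a - b) / 2 * flip_prob R a b = (a + b) / 2 * (t ^+ 2 / (1 + t)).
  rewrite /flip_prob (max_idPr _) ?divr_ge0; try lra.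
  by rewrite /t; field; rewrite !gt_eqF//; lra.
rewrite [X in _ <= X * _ + _]aE [X in _ <= _ + X * _]bE.
rewrite [leRHS](_ : _ = (a + b) / 2 *
  ((1 + t) * ln (1 + t) + (1 - t) * ln (1 - t))); last by ring.
rewrite ler_wpM2l ?divr_ge0 ?(ltW s0)//.
apply: le_trans (entropy_deficit_ge R t _); last by rewrite t0.
have t10 : 0 < 1 + t by lra.
clearbody t; rewrite -subr_ge0.
rewrite (_ : _ - _ = t ^+ 3 * (2 - t) / (3 * (1 + t))); last by field; lra.
by rewrite divr_ge0 ?mulr_ge0 ?exprn_ge0 //; lra.
Qed.

(** * Splitting off the first coordinate of the cube *)

Definition cube_cons (n : nat) (b : bool) (x : cube n) : cube n.+1 :=
  [ffun i => if unlift ord0 i is Some j then x j else b].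

Definition cube_tail (n : nat) (x : cube n.+1) : cube n :=
  [ffun j => x (lift ord0 j)].

Lemma cube_cons0 (n : nat) (b : bool) (x : cube n) : cube_cons n b x ord0 = b.
Proof. by rewrite ffunE unlift_none. Qed.

Lemma cube_cons_lift (n : nat) (b : bool) (x : cube n) (j : 'I_n) :
  cube_cons n b x (lift ord0 j) = x j.
Proof. by rewrite ffunE liftK. Qed.

Lemma cube_consK (n : nat) (b : bool) (x : cube n) :
  cube_tail n (cube_cons n b x) = x.
Proof. by apply/ffunP => j; rewrite ffunE cube_cons_lift. Qed.

Lemma cube_tailK (n : nat) (x : cube n.+1) :
  cube_cons n (x ord0) (cube_tail n x) = x.
Proof.
apply/ffunP => i; rewrite ffunE.
by case: unliftP => [j|] ->; rewrite ?ffunE.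
Qed.

Lemma sum_cube_recl (R : realType) (n : nat) (F : cube n.+1 -> R) :
  \sum_x F x = \sum_(b : bool) \sum_(x : cube n) F (cube_cons n b x).
Proof.
rewrite pair_bigA /= (reindex (fun p => cube_cons n p.1 p.2)) //=.
exists (fun x : cube n.+1 => (x ord0, cube_tail n x)) => [[b x]|x] _ /=.
  by rewrite cube_cons0 cube_consK.
exact: cube_tailK.
Qed.

Lemma cube_addxx (n : nat) (x : cube n) : x + x = 0.
Proof. by apply/ffunP => i; rewrite cube_addE addbb ffunE. Qed.

Lemma bernoulli_vec_pmf_recl (R : realType) (n : nat) (P : 'I_n.+1 -> R)
    (y : cube n.+1) :
  bernoulli_vec_pmf P y = bernoulli_pmf (P ord0) (y ord0) *
    bernoulli_vec_pmf (fun j => P (lift ord0 j)) (cube_tail n y).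
Proof.
rewrite /bernoulli_vec_pmf big_ord_recl; congr *%R.
by apply: eq_bigr => j _; rewrite ffunE.
Qed.

(** * Uniformizing a weight on the cube, one coordinate at a time *)

(** Induction on [n]: balance the masses of the two slices, then use the flips of the slice
    containing [x]. Since [g] is not normalized, the hypothesis applies to each slice as it is, even
    one of mass zero. *)
Lemma exists_uniformizing_flips (R : realType) (n : nat) (g : cube n -> R) :
  (forall x, 0 <= g x) ->
  exists P : cube n -> 'I_n -> R,
    [/\ forall x i, 0 <= P x i <= 1,
        forall z, \sum_x g x * bernoulli_vec_pmf (P x) (x + z) =
                  (\sum_x g x) / 2 ^+ n
      & \sum_x g x * \sum_(i < n) P x i ^+ 2 <=
        \sum_x g x * ln (2 ^+ n * g x / \sum_x g x)].
Proof.
elim: n g => [|n IHn] g g0.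
  exists (fun _ _ => 0); split=> [x i|z|]; first by rewrite lexx ler01.
    rewrite expr0 divr1; apply: eq_bigr => x _.
    by rewrite /bernoulli_vec_pmf big_ord0 mulr1.
  apply: ler_sum => x _; rewrite big_ord0 mulr0 expr0 mul1r.
  rewrite (_ : \sum_y g y = g x); last first.
    rewrite (bigD1 x)//= big1 ?addr0// => y /eqP[].
    by apply/ffunP => -[].
  have [->|gx] := eqVneq (g x) 0; first by rewrite mul0r.
  by rewrite divff// ln1 mulr0.
have /choice[Q QP] : forall b : bool, exists P : cube n -> 'I_n -> R,
    [/\ forall x i, 0 <= P x i <= 1,
        forall z, \sum_x g (cube_cons n b x) * bernoulli_vec_pmf (P x) (x + z) =
                  (\sum_x g (cube_cons n b x)) / 2 ^+ n
      & \sum_x g (cube_cons n b x) * \sum_(i < n) P x i ^+ 2 <=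
        \sum_x g (cube_cons n b x) *
          ln (2 ^+ n * g (cube_cons n b x) / \sum_x g (cube_cons n b x))].
  by move=> b; apply: (IHn (fun x => g (cube_cons n b x))).
pose S b := \sum_x g (cube_cons n b x).
have S0 b : 0 <= S b by apply: sumr_ge0.
have gS : \sum_x g x = S true + S false by rewrite sum_cube_recl big_bool.
pose p b := flip_prob R (S b) (S (~~ b)).
pose P (x : cube n.+1) (i : 'I_n.+1) : R :=
  if unlift ord0 i is Some j then Q (x ord0) (cube_tail n x) j else p (x ord0).
have P0 b x : P (cube_cons n b x) ord0 = p b.
  by rewrite /P unlift_none cube_cons0.
have PS b x j : P (cube_cons n b x) (lift ord0 j) = Q b x j.
  by rewrite /P liftK cube_cons0 cube_consK.
exists P; split.
- move=> x i; rewrite /P; case: unlift => [j|].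
    by case: (QP (x ord0)).
  exact: flip_prob_itv.
- move=> z; rewrite gS sum_cube_recl.
  (* Inside slice [b] the tail becomes uniform whatever the target; the first bit reaches [z ord0]
     by a flip exactly when [b] differs from it. *)
  have H b : \sum_x g (cube_cons n b x) *
      bernoulli_vec_pmf (P (cube_cons n b x)) (cube_cons n b x + z) =
      bernoulli_pmf (p b) (b (+) z ord0) * (S b / 2 ^+ n).
    have [_ QU _] := QP b; rewrite -(QU (cube_tail n z)) mulr_sumr.
    apply: eq_bigr => x _.
    rewrite bernoulli_vec_pmf_recl P0 cube_addE !cube_cons0 mulrCA.
    congr (_ * (_ * _)).
    apply: eq_bigr => j _; congr bernoulli_pmf; first exact: PS.
    by rewrite ffunE !cube_addE cube_cons_lift ffunE.
  rewrite big_bool !H exprS.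
  have B1 := flip_prob_balances R _ _ (S0 true) (S0 false).
  have B2 := flip_prob_balances R _ _ (S0 false) (S0 true).
  have n0 : (2 : R) ^+ n != 0 by rewrite expf_neq0 ?pnatr_eq0.
  rewrite [RHS](_ : _ = (S true + S false) / 2 / 2 ^+ n); last by field.
  case: (z ord0); rewrite /bernoulli_pmf /p /= ?[~~ _]/=.
    by rewrite -B1; ring.
  by rewrite [S true + _]addrC -B2; ring.
- rewrite gS !sum_cube_recl.
  have H b : \sum_x g (cube_cons n b x) *
       \sum_(i < n.+1) P (cube_cons n b x) i ^+ 2 =
      S b * p b ^+ 2 + \sum_x g (cube_cons n b x) * \sum_(i < n) Q b x i ^+ 2.
    rewrite /S mulr_suml -big_split; apply: eq_bigr => x _ /=.
    rewrite big_ord_recl P0 mulrDr; congr (_ + _ * _).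
    by apply: eq_bigr => j _; rewrite PS.
  (* Chain rule: the ratio inside [ln] factors through the slice mass [S b]. Points of weight zero
     are set apart, as [lnM] needs positive factors. *)
  have K b : \sum_x g (cube_cons n b x) *
       ln (2 ^+ n.+1 * g (cube_cons n b x) / (S true + S false)) =
      S b * ln (2 * S b / (S true + S false)) + \sum_x g (cube_cons n b x) *
        ln (2 ^+ n * g (cube_cons n b x) / S b).
    rewrite [S b * _]mulr_suml -[RHS]big_split; apply: eq_bigr => x _ /=.
    have [->|gx] := eqVneq (g (cube_cons n b x)) 0; first by rewrite !mul0r addr0.
    have gx0 : 0 < g (cube_cons n b x) by rewrite lt_def gx g0.
    have Sb0 : 0 < S b.
      by apply: lt_le_trans gx0 _; rewrite /S (bigD1 x)//= lerDl sumr_ge0.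
    have ST0 : 0 < S true + S false.
      by case: (b) Sb0 => Sb0; [apply: ltr_pwDl|apply: ltr_wpDl].
    have n0 : 0 < (2 : R) ^+ n by rewrite exprn_gt0.
    rewrite -mulrDr -lnM ?posrE ?divr_gt0 ?mulr_gt0//.
    congr (_ * ln _); rewrite exprS; field.
    by rewrite !gt_eqF.
  rewrite !big_bool /= !H !K.
  have [_ _ Q1] := QP true; have [_ _ Q2] := QP false.
  have C := flip_prob_cost R _ _ (S0 true) (S0 false).
  rewrite addrACA [leRHS]addrACA; apply: lerD; first exact: C.
  exact: lerD.
Qed.

(** * Flips for the uniform law on a set *)

Lemma prob_bernoulli_vec_shift (R : realType) (n : nat) (P : 'I_n -> R)
    (x : cube n) (A : {set cube n}) :
  prob_bernoulli_vec P [set y : cube n | x + y \in A] =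
  \sum_(z in A) bernoulli_vec_pmf P (x + z).
Proof.
have xK : involutive (fun z : cube n => x + z).
  by move=> z; rewrite addrA cube_addxx add0r.
rewrite /prob_bernoulli_vec (reindex_inj (inv_inj xK)).
by apply: eq_bigl => z; rewrite inE xK.
Qed.

(** Taking the indicator of [B] as weight, the total is [#|B|] and each point of [B] contributes the
    same logarithm. *)
Lemma exists_mixing_flips (R : realType) (n : nat) (A B : {set cube n}) :
  exists P : cube n -> 'I_n -> R,
    [/\ forall x i, 0 <= P x i <= 1,
        \sum_(x in B) prob_bernoulli_vec (P x) [set y : cube n | x + y \in A] =
          #|B|%:R * mu R A
      & \sum_(x in B) \sum_(i < n) P x i ^+ 2 <=
          #|B|%:R * ln (2 ^+ n / #|B|%:R)].
Proof.
have [|P [P01 PU PE]] := @exists_uniformizing_flips R n (fun x => (x \in B)%:R).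
  by move=> x; rewrite ler0n.
have gB : \sum_x (x \in B)%:R = #|B|%:R :> R.
  rewrite -sum1_card natr_sum [RHS]big_mkcond.
  by apply: eq_bigr => x _; case: (x \in B).
exists P; split=> //.
  under eq_bigr do rewrite prob_bernoulli_vec_shift.
  rewrite exchange_big /= /mu -sum1_card natr_sum mulr_suml mulr_sumr.
  apply: eq_bigr => z _; rewrite mul1r -gB -(PU z) [LHS]big_mkcond.
  by apply: eq_bigr => x _; case: (x \in B); rewrite ?mul1r ?mul0r.
move: PE; rewrite gB.
rewrite (_ : \sum_x _ = \sum_(x in B) \sum_(i < n) P x i ^+ 2); last first.
  rewrite [RHS]big_mkcond.
  by apply: eq_bigr => x _; case: (x \in B); rewrite ?mul1r ?mul0r.
move=> /le_trans; apply.
rewrite -[X in _ <= X * _]gB mulr_suml.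
by apply: ler_sum => x _; case: (x \in B); rewrite ?mulr1 ?mul0r.
Qed.

(** * Averaging over the bad points *)

Theorem theorem1p1 (R : realType) (epsilon delta : R)
    (epsilon_gt0 : 0 < epsilon) (delta_gt0 : 0 < delta)
    (n : nat) (n_gt0 : (0 < n)%N) (A : {set cube n}) :
  (1 - epsilon) * 2 ^+ n <=
  #|[set x : cube n | `[<
      exists P : 'I_n -> R,
        [/\ forall i, 0 <= P i <= 1,
            \sum_(i < n) P i ^+ 2 <= ln (2 / epsilon) / (2 * delta * epsilon)
          & mu R A - delta <=
            prob_bernoulli_vec P [set y : cube n | x + y \in A]] >] ]|%:R.
Proof.
set G := [set x | _].
pose K := ln (2 / epsilon) / (2 * delta * epsilon).
have two_n0 : 0 < (2 : R) ^+ n by rewrite exprn_gt0.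
case: (lerP 1 epsilon) => [eps1|eps1].
  by rewrite (le_trans _ (ler0n _ _))// mulr_le0_ge0 ?(ltW two_n0)//; lra.
have lnK0 : 0 < ln (2 / epsilon) by rewrite ln_gt0// ltr_pdivlMr//; lra.
have K0 : 0 < K by rewrite divr_gt0// !mulr_gt0.
rewrite leNgt; apply/negP => Gsmall.
pose B := ~: G.
have cardGB : #|G|%:R + #|B|%:R = 2 ^+ n :> R.
  by rewrite -natrD /B cardsC card_ffun card_bool card_ord natrX.
have Blarge : epsilon * 2 ^+ n < #|B|%:R by lra.
have B0 : 0 < #|B|%:R :> R by apply: le_lt_trans Blarge; rewrite mulr_ge0 ?ltW.
have [P [P01 Pmean Pcost]] := exists_mixing_flips R n A B.
have badP x : x \in B -> \sum_(i < n) P x i ^+ 2 <= K ->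
    prob_bernoulli_vec (P x) [set y : cube n | x + y \in A] < mu R A - delta.
  rewrite !inE => /asboolPn nP PK; rewrite ltNge; apply/negP => muP.
  by apply: nP; exists (P x).
have prob_ge0 (Q : 'I_n -> R) E : (forall i, 0 <= Q i <= 1) ->
    0 <= prob_bernoulli_vec Q E.
  by move=> Q01; apply: sumr_ge0 => y _; exact: bernoulli_vec_pmf_ge0.
have prob_le1 (Q : 'I_n -> R) E : (forall i, 0 <= Q i <= 1) ->
    prob_bernoulli_vec Q E <= 1.
  move=> Q01; rewrite -(prob_bernoulli_vecT Q) /prob_bernoulli_vec.
  rewrite [leLHS]big_mkcond [leRHS]big_mkcond; apply: ler_sum => y _.
  by rewrite inE; case: ifP => // _; exact: bernoulli_vec_pmf_ge0.
(* If this failed, [P = 0] would make every point good, but [B] is nonempty. *)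
have mu_delta : 0 <= mu R A - delta.
  have /card_gt0P[x xB] : (0 < #|B|)%N by rewrite -(ltr0n R).
  rewrite leNgt; apply/negP => mu_delta.
  move: xB; rewrite !inE => /asboolPn; apply.
  exists (fun=> 0); split=> [i||]; first by rewrite lexx ler01.
    by rewrite big1 ?ltW// => i _; rewrite expr0n.
  by rewrite (le_trans (ltW mu_delta))// prob_ge0// => i; rewrite lexx ler01.
have markov : #|B|%:R * mu R A <=
    #|B|%:R * (mu R A - delta) + #|B|%:R * ln (2 ^+ n / #|B|%:R) / K.
  (* Markov pointwise: cost at most [K] lets badness bound the probability; above [K] the term
     [cost / K] is at least [1], and [mu_delta] keeps the rest nonnegative. *)
  rewrite -Pmean mulr_natl -sumr_const.
  apply: le_trans (_ : _ <= \sum_(x in B)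
    (mu R A - delta + (\sum_(i < n) P x i ^+ 2) / K)) _.
    apply: ler_sum => x xB.
    have N0 : 0 <= \sum_(i < n) P x i ^+ 2 by apply: sumr_ge0 => i _; exact: sqr_ge0.
    case: (lerP (\sum_(i < n) P x i ^+ 2) K) => [PK|/ltW PK].
      by rewrite ler_wpDr ?(divr_ge0 N0 (ltW K0))// (ltW (badP _ xB PK)).
    by rewrite (le_trans (prob_le1 _ _ (P01 x)))// ler_wpDl// ler_pdivlMr ?mul1r.
  by rewrite big_split /= lerD2l -mulr_suml ler_wpM2r// invr_ge0 ltW.
pose s := ln epsilon^-1.
have ln_le_s : ln (2 ^+ n / #|B|%:R) <= s.
  rewrite ler_ln ?posrE ?divr_gt0 ?invr_gt0//.
  rewrite ler_pdivrMr// mulrC ler_pdivlMr// mulrC; exact: ltW.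
have delta_le : delta * K <= s.
  have : delta <= ln (2 ^+ n / #|B|%:R) / K.
    by rewrite -(ler_pM2l B0) mulrA; lra.
  by rewrite ler_pdivlMr// => /le_trans; apply.
have lnE : ln (2 / epsilon) = ln 2 + s by rewrite lnM ?posrE ?invr_gt0.
have ln20 : 0 < ln 2 :> R by apply: ln_gt0; lra.
(* Here [delta] cancels: [delta * K] equals [(ln 2 + s) / (2 * epsilon)]. The resulting bound is
   impossible for [epsilon < 1]. *)
have {delta_le} : ln 2 + s <= s * (2 * epsilon).
  by rewrite -lnE -ler_pdivrMr ?mulr_gt0//; apply: le_trans delta_le;
    rewrite /K le_eqVlt; apply/orP; left; apply/eqP; field; rewrite !gt_eqF.
have s0 : 0 <= s by rewrite ln_ge0// invf_ge1// ltW.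
(* If epsilon <= 1/2 then [s * (2 * epsilon) <= s]; otherwise [s < ln 2]. *)
case: (lerP epsilon 2^-1) => [eps_half|eps_half] H; first by nra.
have : s < ln 2.
  by rewrite ltr_ln ?posrE ?invr_gt0// -[ltRHS]invrK ltf_pV2 ?posrE ?invr_gt0.
nra.
Qed.
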